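(* Let $B$ be a unital commutative semi-simple Banach algebra with connected maximal ideal space $X$, and let $T$ be a unital endomorphism of $B$ which is a Riesz operator. Then $\{f\in B: Tf=f\}$ is one dimensional; that is, the eigenvalue $1$ of $T$ has multiplicity $1$, and $Tf=f$ implies that $f$ is a constant multiple of $1$.
   Context: A unital endomorphism of $B$ is a linear multiplicative map $T:B\to B$ with $T1=1$. A bounded operator $T$ is a Riesz operator if $\lim_{n}\left[\inf\{\|T^n-K\|:K \text{ compact}\}\right]^{1/n}=0$. The maximal ideal space carries the Gelfand topology. *)

(* Defs.v *)
From HB Require Import structures.
From mathcomp Require Import all_boot all_order all_algebra.
From mathcomp Require Import all_classical all_reals all_analysis.
From mathcomp.real_closed Require Import complex.
Set Implicit Arguments. Unset Strict Implicit. Unset Printing Implicit Defensive.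
Import Order.TTheory GRing.Theory Num.Theory.
Import numFieldNormedType.Exports.
Local Open Scope classical_set_scope.
Local Open Scope ring_scope.

(* A unital commutative complex Banach algebra is represented by a complete
   normed C-module A (C = R[i]) together with a multiplication [mul] and a
   unit [one] satisfying the axioms below.  (HB cannot join
   completeNormedModType with comAlgType.) *)

Section BanachDefs.
Variable (R : realType).
Local Notation C := (R[i]).
Variable (A : completeNormedModType C).
Variables (mul : A -> A -> A) (one : A).

Definition comBanachAlgebra : Prop :=
  [/\ (forall x y z, mul x (mul y z) = mul (mul x y) z),
      (forall x y, mul x y = mul y x),
      (forall x, mul one x = x) &
      (forall x y z, mul x (y + z) = mul x y + mul x z)] /\
  [/\ (forall (a : C) x y, mul (a *: x) y = a *: mul x y),
      one != 0 &
      (forall x y, `|mul x y| <= `|x| * `|y|)].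

Definition is_linear (S : A -> A) : Prop :=
  forall (a : C) (x y : A), S (a *: x + y) = a *: S x + S y.

Definition unital_endomorphism (T : A -> A) : Prop :=
  [/\ is_linear T, (forall x y, T (mul x y) = mul (T x) (T y)) & T one = one].

(* ring ideals, maximal ideals, semisimplicity (Jacobson radical = 0; for a
   commutative unital algebra the radical is the intersection of all maximal
   ideals). *)
Definition ideal (I : set A) : Prop :=
  [/\ I 0, (forall x y, I x -> I y -> I (x + y)) &
      (forall a x, I x -> I (mul a x))].

Definition maximal_ideal (I : set A) : Prop :=
  [/\ ideal I, ~ I one &
      forall J : set A, ideal J -> ~ J one -> I `<=` J -> J = I].

Definition semisimple : Prop :=
  forall f : A, (forall I, maximal_ideal I -> I f) -> f = 0.

(* Points of the maximal ideal space are identified (as usual, via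
   M = ker phi) with the characters: nonzero multiplicative linear
   functionals A -> C. *)
Definition character (phi : A -> C) : Prop :=
  [/\ (forall (a : C) (x y : A), phi (a *: x + y) = a * phi x + phi y),
      (forall x y, phi (mul x y) = phi x * phi y) & phi one = 1].

Definition max_ideal_space : set (A -> C) := [set phi | character phi].

(* Gelfand topology: the weakest topology on the characters making every
   evaluation phi |-> phi f continuous; its open sets are the U such that
   every point phi of U has a basic neighbourhood
   {psi | forall f in s, |psi f - phi f| < e} (s finite, e > 0) inside U. *)
Definition gelfand_open (U : set (A -> C)) : Prop :=
  U `<=` max_ideal_space /\
  forall phi, U phi -> exists (s : seq A) (e : C), 0 < e /\
    forall psi, character psi ->
      (forall f, f \in s -> `|psi f - phi f| < e) -> U psi.

Definition max_ideal_space_connected : Prop :=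
  forall U V : set (A -> C), gelfand_open U -> gelfand_open V ->
    max_ideal_space `<=` U `|` V -> U `&` V = set0 -> U = set0 \/ V = set0.

Definition bounded_operator (S : A -> A) : Prop :=
  is_linear S /\ exists M : C, forall x, `|S x| <= M * `|x|.

Definition compact_operator (K : A -> A) : Prop :=
  is_linear K /\ compact (closure (K @` [set x : A | `|x| <= 1])).

(* operator norm (norms in a normed C-module are elements of C with zero
   imaginary part; we take their real part to get a real number) *)
Definition op_norm (S : A -> A) : R :=
  sup [set complex.Re `|S x| | x in [set x : A | `|x| <= 1]].

Definition ess_norm (S : A -> A) : R :=
  inf [set op_norm (fun x => S x - K x) | K in compact_operator].

Definition riesz_operator (T : A -> A) : Prop :=
  bounded_operator T /\
  (fun n : nat => powR (ess_norm (iter n T)) (n%:R)^-1) @ \oo --> (0 : R).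

End BanachDefs.

(* Main.v *)
Require Import Defs.
From HB Require Import structures.
From mathcomp Require Import all_boot all_order all_algebra.
From mathcomp Require Import all_classical all_reals all_analysis.
From mathcomp.real_closed Require Import complex.
From mathcomp Require Import ring lra.
Import Order.TTheory GRing.Theory Num.Theory.
Import numFieldNormedType.Exports.
Import ComplexField.Normc.
Local Open Scope classical_set_scope.
Local Open Scope ring_scope.

(* The fixed space F of T is a unital subalgebra on which every iterate of T is
   the identity; some iterate is within 1/16 of a compact operator, so F has no
   1/2-separated sequence of unit vectors.  Let f be in F.  If f took infinitely
   many values phi_n(f) on characters, the subspaces
   M_n = {g in F | phi_i(g) = 0 for i < n} would decrease strictly, and taking
   g_n in the unit ball of M_n nearly maximising |phi_n| gives such a sequence.
   So the Gelfand transform of f has finitely many values, hence is constant by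
   connectedness of the maximal ideal space, and semisimplicity makes f a scalar.
   The last step needs every maximal ideal to be the kernel of a character,
   which is the Gelfand-Mazur theorem. *)

(** * The modulus of complex numbers *)

Lemma normc_ge0 {R : rcfType} (c : R[i]) : 0 <= normc c.
Proof. by case: c => a b; rewrite /= sqrtr_ge0. Qed.

Lemma normc_real {R : rcfType} (a : R) : normc (a%:C)%C = `|a|.
Proof. by rewrite /= expr0n /= addr0 sqrtr_sqr. Qed.

Lemma normc_leD {R : rcfType} (a b : R) : normc (a +i* b)%C <= `|a| + `|b|.
Proof.
have -> : (a +i* b)%C = a%:C%C + (0 +i* b)%C.
  by apply/eqP; rewrite eq_complex /= addr0 add0r !eqxx.
apply: (le_trans (le_normcD _ _)); rewrite normc_real lerD2l /=.
by rewrite expr0n add0r sqrtr_sqr.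
Qed.

Lemma normc_geRe {R : rcfType} (c : R[i]) : `|complex.Re c| <= normc c.
Proof.
case: c => a b /=; rewrite -(sqrtr_sqr a) ler_sqrt ?addr_ge0 ?sqr_ge0 //.
by rewrite lerDl sqr_ge0.
Qed.

Lemma normc_geIm {R : rcfType} (c : R[i]) : `|complex.Im c| <= normc c.
Proof.
case: c => a b /=; rewrite -(sqrtr_sqr b) ler_sqrt ?addr_ge0 ?sqr_ge0 //.
by rewrite lerDr sqr_ge0.
Qed.

Lemma normcX {R : rcfType} (c : R[i]) n : normc (c ^+ n) = normc c ^+ n.
Proof. by elim: n => [|n IH]; rewrite ?expr0 ?normc1 // !exprS normcM IH. Qed.

Lemma half_expr_le {R : realType} {e : R} : 0 < e ->
  exists n : nat, (2^-1) ^+ n <= e.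
Proof.
move=> e0; have /cvgrPdist_le/(_ e e0) [n _ /(_ n (leqnn n))] :
    ((fun n => (2^-1 : R) ^+ n) @ \oo --> (0 : R)).
  by apply: cvg_expr; rewrite ger0_norm ?invr_ge0 // invf_lt1 // ltr1n.
by rewrite sub0r normrN ger0_norm ?exprn_ge0 ?invr_ge0 // => h; exists n.
Qed.

(** Square roots are extracted repeatedly, starting from -1. Multiplying [c] by such a [z] changes
    the sign of [c ^+ (2 ^ m)] and preserves the modulus of [c], which drives the averaging argument
    below. *)
Lemma exp2_root (R : rcfType) (m : nat) :
  exists2 z : R[i], z ^+ (2 ^ m) = -1 & normc z = 1.
Proof.
have [z zm] : exists z : R[i], z ^+ (2 ^ m) = -1.
  elim: m => [|m [z zm]]; first by exists (-1); rewrite expn0 expr1.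
  by exists (sqrtc z); rewrite expnS exprM sqr_sqrtc.
exists z => //; apply/eqP.
rewrite -(@pexpr_eq1 _ _ (2 ^ m)) ?expn_gt0 ?normc_ge0 //.
by rewrite -normcX zm normcN normc1.
Qed.

(** * The Gelfand-Mazur theorem *)

(* Suppose x lies outside the scalars.  The averages of h c = (1 - c x)^-1 over
   the 2^m-th roots of unity are H m c = (1 - (c x)^(2^m))^-1, so the bound and
   the Lipschitz constant of h pass to all H m.  Smallness of (r x)^(2^m) for
   large m means that H m r is close to 1, and by the uniform Lipschitz bound it
   propagates from r to r + d with d independent of r.  For r large this
   contradicts the smallness of (r x)^-1. *)
Section GelfandMazur.
Variables (R : realType) (K : fieldType) (iota : {rmorphism R[i] -> K}).
Variable N : K -> R.
Hypothesis N_ge0 : forall x, 0 <= N x.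
Hypothesis ND : forall x y, N (x + y) <= N x + N y.
Hypothesis NM : forall x y, N (x * y) <= N x * N y.
Hypothesis NZ : forall c x, N (iota c * x) <= normc c * N x.
Hypothesis N1_gt0 : 0 < N 1.

Let N1_ge1 : 1 <= N 1.
Proof. by have := NM 1 1; rewrite mulr1 ler_pMr. Qed.

Let N0 : N 0 = 0.
Proof.
apply/eqP; rewrite eq_le N_ge0 andbT.
by have := NZ 0 0; rewrite mulr0 normc0 mul0r.
Qed.

Let NN x : N (- x) = N x.
Proof.
have le y : N (- y) <= N y.
  by have := NZ (-1) y; rewrite rmorphN1 mulN1r normcN normc1 mul1r.
by apply/eqP; rewrite eq_le le /= -{1}(opprK x) le.
Qed.

Let NB x y : N (x - y) <= N x + N y.
Proof. by rewrite (le_trans (ND _ _)) // NN. Qed.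

Let NX x n : N (x ^+ n.+1) <= N x ^+ n.+1.
Proof.
elim: n => [|n IH]; first by rewrite !expr1.
rewrite exprS [leRHS]exprS (le_trans (NM _ _)) // ler_wpM2l //.
Qed.

Variable x : K.
Hypothesis x_out : forall c, x != iota c.

Let x_neq0 : x != 0. Proof. by have := x_out 0; rewrite rmorph0. Qed.

Let d_neq0 c : 1 - iota c * x != 0.
Proof.
apply/negP => /eqP/subr0_eq E.
have c0 : iota c != 0 by apply: contra_eq_neq E => ->; rewrite mul0r oner_neq0.
have /negP := x_out c^-1; apply; apply/eqP.
by rewrite fmorphV -[RHS]mulr1 E mulKf.
Qed.

Let h c := (1 - iota c * x)^-1.

(** The resolvent identity: it yields both the local bound on [h] and its Lipschitz constant. *)
Let h_sub a b : h a - h b = iota (a - b) * (x * (h a * h b)).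
Proof.
rewrite /h rmorphB; field.
by rewrite !d_neq0.
Qed.

(** The resolvent identity gives [N (h a) <= N (h b) + N (h a) / 2], and the last term is absorbed
    on the left. *)
Let h_near b a : normc (a - b) * (N x * N (h b)) <= 2^-1 ->
  N (h a) <= 2 * N (h b).
Proof.
move=> small; have : N (h a) <= N (h b) + 2^-1 * N (h a).
  rewrite -{1}(subrK (h b) (h a)) addrC (le_trans (ND _ _)) // lerD2l h_sub.
  rewrite (le_trans (NZ _ _)) //.
  have := ler_wpM2r (N_ge0 (h a)) small; apply: le_trans.
  rewrite -!mulrA ler_wpM2l ?normc_ge0 // (le_trans (NM _ _)) //.
  by rewrite ler_wpM2l // mulrC (le_trans (NM _ _)) // mulrC.
lra.
Qed.

Let Nxi_gt0 : 0 < N x^-1.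
Proof.
rewrite lt_def N_ge0 andbT; apply: contraTneq N1_gt0 => E.
by rewrite -(mulfV x_neq0) -leNgt (le_trans (NM _ _)) // E mulr0.
Qed.

(** From [iota c * h c = x^-1 * (h c - 1)] one gets [normc c * N (h c) <= N x^-1 * (N (h c) + N 1)];
    for large [c] the left side is at least twice [N x^-1 * N (h c)]. *)
Let h_far c : 2 * N x^-1 <= normc c -> N (h c) <= N 1.
Proof.
move=> far; have nc0 : 0 < normc c by have := Nxi_gt0; lra.
have c0 : c != 0 by apply: contraTneq nc0 => ->; rewrite normc0 ltxx.
have E : iota c * h c = x^-1 * (h c - 1).
  by rewrite /h; field; rewrite d_neq0 x_neq0.
have le1 : normc c * N (h c) <= N (iota c * h c).
  rewrite -ler_pdivlMl // -normcV.
  have {1}-> : h c = iota c^-1 * (iota c * h c).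
    by rewrite mulrA -rmorphM mulVf // rmorph1 mul1r.
  exact: NZ.
have le2 : N (iota c * h c) <= N x^-1 * (N (h c) + N 1).
  by rewrite E (le_trans (NM _ _)) // ler_wpM2l.
have le3 : 2 * N x^-1 * N (h c) <= normc c * N (h c) by rewrite ler_wpM2r.
by rewrite -(ler_pM2l Nxi_gt0); lra.
Qed.

Let h_bounded : exists M, forall c, N (h c) <= M.
Proof.
pose rho := 2 * N x^-1.
have cpt : compact (`[- rho, rho] `*` `[- rho, rho] : set (R * R)).
  by apply: compact_setX; apply: segment_compact.
(* Compactness in its covering form: a bound valid near each point for all large [M] is valid on the
   whole square for all large [M]. *)
have /compact_near_coveringP/(_ R (+oo%R)
    (fun M p => N (h (p.1 +i* p.2)%C) <= M) _) := cpt.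
case=> [p _|M0 [_ /(_ (M0 + 1)) bnd]].
  case: p => p1 p2; set t := N x * N (h (p1 +i* p2)%C).
  have t0 : 0 <= t by rewrite mulr_ge0.
  (* The box of half-side [d] lies within modulus [2 * d] of its centre, and [2 * d * t <= 1/2] is
     what [h_near] asks for. *)
  have [d d0 dE] : exists2 d, 0 < d & d * (4 * (t + 1)) = 1.
    exists (4 * (t + 1))^-1; first by rewrite invr_gt0; lra.
    by rewrite mulVf // gt_eqF //; lra.
  exists (ball (p1, p2) d, [set M | 2 * N (h (p1 +i* p2)%C) < M]).
    split; first exact: nbhsx_ballx.
    by exists (2 * N (h (p1 +i* p2)%C)); split; rewrite ?num_real.
  case=> -[a b] M [[/= ba bb] /ltW]; apply: le_trans; apply: h_near.
  rewrite /ball /= in ba bb.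
  have -> : (a +i* b)%C - (p1 +i* p2)%C = ((a - p1) +i* (b - p2))%C by [].
  have nle : normc ((a - p1) +i* (b - p2))%C <= 2 * d.
    by rewrite (le_trans (normc_leD _ _)) // distrC (distrC b); lra.
  by apply: (le_trans (ler_wpM2r t0 nle)); lra.
exists (M0 + 1 + N 1 + N (h 0)) => c.
have M1 : M0 < M0 + 1 by rewrite ltrDl.
have {}bnd := bnd M1.
have M_ge0 : 0 <= M0 + 1.
  apply: le_trans (N_ge0 (h (0 +i* 0)%C)) (bnd (0, 0) _).
  by rewrite /= !in_itv /= oppr_le0 mulr_ge0 // ltW.
have := N_ge0 (h 0); have := N_ge0 1.
have [/h_far|near] := leP (2 * N x^-1) (normc c); first by lra.
have := bnd (complex.Re c, complex.Im c).
have -> : (complex.Re c +i* complex.Im c)%C = c by case: c {near}.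
move=> /(_ _); rewrite /= !in_itv /= -!ler_norml.
rewrite (le_trans (normc_geRe _) (ltW near)) (le_trans (normc_geIm _) (ltW near)).
move=> /(_ (conj isT isT)); lra.
Qed.

Let H m c := (1 - (iota c * x) ^+ (2 ^ m))^-1.

(** Induction on [1 - a ^+ 2 = (1 - a) * (1 + a)] with [a = (iota c * x) ^+ (2 ^ m)]: the second
    factor is the first one taken at [z * c]. *)
Let D_neq0 m c : 1 - (iota c * x) ^+ (2 ^ m) != 0.
Proof.
elim: m c => [|m IH] c; first by rewrite expn0 expr1.
have [z zm z1] := exp2_root R m.
have -> : 1 - (iota c * x) ^+ (2 ^ m.+1) =
    (1 - (iota c * x) ^+ (2 ^ m)) * (1 - (iota (z * c) * x) ^+ (2 ^ m)).
  rewrite rmorphM -mulrA (exprMn _ (iota z)) -(rmorphXn iota _ z) zm rmorphN1 mulN1r opprK.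
  by rewrite expnS mulnC exprM -{1}(expr1n _ 2) subr_sqr.
by rewrite mulf_neq0.
Qed.

(** The partial fraction [1 / (1 - a^2) = (1 / (1 - a) + 1 / (1 + a)) / 2]. *)
Let H_avg m z c : z ^+ (2 ^ m) = -1 ->
  H m.+1 c = iota 2^-1 * (H m c + H m (z * c)).
Proof.
move=> zm; have D1 := D_neq0 m c; have D2 := D_neq0 m (z * c).
have D3 := D_neq0 m.+1 c.
move: D1 D2 D3; rewrite /H rmorphM -mulrA (exprMn _ (iota z)) -(rmorphXn iota _ z) zm rmorphN1 mulN1r.
rewrite opprK expnS mulnC exprM fmorphV.
have : iota 2 != 0 by rewrite fmorph_eq0 pnatr_eq0.
have -> : iota 2 = 2 by rewrite rmorph_nat.
move: ((iota c * x) ^+ (2 ^ m)) => a two0 D1 D2 D3; field.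
by rewrite D1 D2 two0 D3.
Qed.

Let N_half a b : N (iota 2^-1 * (a + b)) <= 2^-1 * (N a + N b).
Proof.
rewrite (le_trans (NZ _ _)) //.
have -> : (2^-1 : R[i]) = (2^-1)%:C%C by rewrite fmorphV rmorph_nat.
by rewrite normc_real ger0_norm ?invr_ge0 // ler_wpM2l ?invr_ge0.
Qed.

Let H_bounded M m c : (forall c, N (h c) <= M) -> N (H m c) <= M.
Proof.
move=> hM; elim: m c => [|m IH] c; first by rewrite /H expn0 expr1; exact: hM.
have [z zm _] := exp2_root R m.
rewrite (H_avg _ _ _ zm) (le_trans (N_half _ _)) //.
by have := IH c; have := IH (z * c); lra.
Qed.

(** Only [c = 1] is used later, but averaging replaces [c] by [z * c], so the induction runs over
    the whole unit circle. *)
Let H_lipschitz M m (s t : R) c : (forall c, N (h c) <= M) -> normc c = 1 ->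
  N (H m (s%:C%C * c) - H m (t%:C%C * c)) <= `|s - t| * (N x * (M * M)).
Proof.
move=> hM; elim: m c => [|m IH] c c1.
  rewrite /H !expn0 !expr1 h_sub (le_trans (NZ _ _)) //.
  rewrite -mulrBl -rmorphB normcM c1 mulr1 normc_real ler_wpM2l //.
  by rewrite (le_trans (NM _ _)) // ler_wpM2l // (le_trans (NM _ _)) // ler_pM.
have [z zm z1] := exp2_root R m.
rewrite !(H_avg _ _ _ zm) -mulrBr opprD addrACA (le_trans (N_half _ _)) //.
rewrite !(mulrCA z).
have zc1 : normc (z * c) = 1 by rewrite normcM z1 c1 mulr1.
by have := IH c c1; have := IH _ zc1; lra.
Qed.

(** A limit-free way to say that the spectral radius of [r x] is less than 1. *)
Let good (r : R) := exists m, N ((iota r%:C%C * x) ^+ (2 ^ m)) <= 2^-1.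

Let good_step : exists2 d, 0 < d & forall r, good r -> good (r + d).
Proof.
have [M hM] := h_bounded.
pose L := N x * (M * M).
have M0 : 0 <= M by apply: le_trans (hM 0).
have L0 : 0 <= L by rewrite !mulr_ge0.
(* With this [e], the final inequality [N b <= e * (N 1 + N b)] gives exactly [N b <= 1/2]. *)
pose e : R := (2 * N 1 + 1)^-1.
have eE : e * (2 * N 1 + 1) = 1 by rewrite mulVf // gt_eqF //; have := N1_gt0; lra.
have e0 : 0 < e by rewrite invr_gt0; have := N1_gt0; lra.
pose d := e / 2 / (L + 1).
have dE : d * (L + 1) = e / 2 by rewrite /d mulfVK // gt_eqF //; lra.
have d0 : 0 < d by rewrite !divr_gt0 //; lra.
exists d => // r [m rm].
(* Passing from [m] to [m + k] brings [N a] below [(1/2)^(2^k)], small enough for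
   [M * N a <= e / 2]. *)
have e'0 : 0 < e / 2 / (M + 1) by rewrite !divr_gt0 //; lra.
have [k ke] := half_expr_le e'0.
exists (m + k)%N.
set a := (iota r%:C%C * x) ^+ (2 ^ (m + k)).
have aE : N a <= e / 2 / (M + 1).
  apply: le_trans ke; rewrite /a expnD exprM.
  move: rm; set b := (iota _ * x) ^+ _ => rm.
  have /prednK <- : (0 < 2 ^ k)%N by rewrite expn_gt0.
  apply: (le_trans (NX _ _)); rewrite prednK ?expn_gt0 //.
  apply: (@le_trans _ _ (2^-1 ^+ (2 ^ k))); first by rewrite lerXn2r ?nnegrE ?invr_ge0.
  apply: ler_wiXn2l; rewrite ?invr_ge0 ?invf_le1 ?ler1n //.
  by rewrite ltnW // ltn_expl.
have Ma : M * N a <= e / 2.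
  have qE : e / 2 / (M + 1) * (M + 1) = e / 2 by rewrite mulfVK // gt_eqF //; lra.
  by have := ler_wpM2l M0 aE; lra.
set b := (iota (r + d)%:C%C * x) ^+ (2 ^ (m + k)).
pose Ha := H (m + k) r%:C%C; pose Hb := H (m + k) (r + d)%:C%C.
have Da : 1 - a != 0 by exact: D_neq0.
have Db : 1 - b != 0 by exact: D_neq0.
(* Smallness of [a] puts [Ha] close to 1, the Lipschitz bound then puts [Hb] close to 1, and solving
   for [b] turns this into smallness of [b]. *)
have Ha1 : Ha - 1 = Ha * a by rewrite /Ha /H -/a; field.
have HbE : b = (Hb - 1) * (1 - b) by rewrite /Hb /H -/b; field.
have NHb1 : N (Hb - 1) <= e.
  have -> : Hb - 1 = (Hb - Ha) + Ha * a by rewrite -Ha1 addrA subrK.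
  rewrite (le_trans (ND _ _)) //.
  have := @H_lipschitz M (m + k) (r + d) r 1 hM (normc1 _).
  rewrite !mulr1 -/Ha -/Hb (addrC r) addrK (ger0_norm (ltW d0)) -/L => le1.
  have le2 : N (Ha * a) <= M * N a.
    by rewrite (le_trans (NM _ _)) // ler_wpM2r // H_bounded.
  lra.
have : N b <= e * (N 1 + N b).
  by rewrite {1}HbE (le_trans (NM _ _)) // ler_pM // NB.
have := N_ge0 b; have := N1_gt0; nra.
Qed.

Lemma gelfand_mazur_contra : False.
Proof.
have [d d0 step] := good_step.
have good_nat n : good (d *+ n).
  elim: n => [|n IH]; last by rewrite mulrSr; exact: step.
  by exists 0%N; rewrite mulr0n rmorph0 mul0r expn0 expr1 N0 invr_ge0.
(* For [r] this large, some power of [r x] and the inverse of that power both have norm at most 1/2,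
   so [N 1 <= 1/4], against [1 <= N 1]. *)
pose n := Num.bound (2 * N x^-1 / d).
have nd : 2 * N x^-1 < d *+ n.
  rewrite -[d *+ n]mulr_natl -ltr_pdivrMr //.
  have : 0 <= 2 * N x^-1 / d by rewrite divr_ge0 ?mulr_ge0 ?ltW.
  by move=> /archi_boundP.
have [m Nm] := good_nat n; move: Nm; set r := d *+ n in nd * => Nm.
have r0 : 0 < r by apply: le_lt_trans nd; rewrite mulr_ge0.
set y := iota r%:C%C * x in Nm.
have y0 : y != 0 by rewrite mulf_neq0 // fmorph_eq0 (inj_eq (@complexI _) _ 0) gt_eqF.
have yV : N y^-1 <= 2^-1.
  rewrite /y invfM -fmorphV (le_trans (NZ _ _)) // normcV normc_real gtr0_norm //.
  by rewrite mulrC ler_pdivrMr //; lra.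
have yVm : N (y^-1 ^+ (2 ^ m)) <= 2^-1.
  have /prednK E : (0 < 2 ^ m)%N by rewrite expn_gt0.
  rewrite -E (le_trans (NX _ _)) // exprS.
  rewrite -[leRHS]mulr1 ler_pM ?exprn_ge0 // exprn_ile1 // (le_trans yV) //.
  by rewrite invf_le1 ?ler1n.
have : N 1 <= 2^-1 * 2^-1.
  have <- : y ^+ (2 ^ m) * y^-1 ^+ (2 ^ m) = 1.
    by rewrite exprVn mulfV // expf_neq0.
  by rewrite (le_trans (NM _ _)) // ler_pM.
have := N1_ge1; lra.
Qed.
End GelfandMazur.

(** The form is chosen to fit the residue field of a maximal ideal with its quotient seminorm. *)
Lemma gelfand_mazur (R : realType) (K : fieldType)
    (iota : {rmorphism R[i] -> K}) (N : K -> R) :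
  (forall x, 0 <= N x) -> (forall x y, N (x + y) <= N x + N y) ->
  (forall x y, N (x * y) <= N x * N y) ->
  (forall c x, N (iota c * x) <= normc c * N x) -> 0 < N 1 ->
  forall x, exists c, x = iota c.
Proof.
move=> N_ge0 ND NM NZ N1 x; apply: contrapT => /forallNP x_out.
by apply: (gelfand_mazur_contra _ _ _ _ N_ge0 ND NM NZ N1 x) => c; apply/eqP.
Qed.

Set Implicit Arguments.

(** * Norms as real numbers, and the Neumann series *)

Section Norm.
Variables (R : realType) (A : normedModType R[i]).
Implicit Types x y : A.

Definition nrm x : R := complex.Re `|x|.

Lemma nrmE x : `|x| = (nrm x)%:C%C.
Proof. by rewrite RRe_real // normr_real. Qed.

Lemma nrm_le x (r : R) : (`|x| <= r%:C%C) = (nrm x <= r).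
Proof. by rewrite nrmE lecR. Qed.

Lemma nrm_lt x (r : R) : (`|x| < r%:C%C) = (nrm x < r).
Proof. by rewrite nrmE ltcR. Qed.

Lemma nrm_ge0 x : 0 <= nrm x.
Proof. by rewrite -ler0c -nrmE. Qed.

Lemma nrm0 : nrm (0 : A) = 0.
Proof. by rewrite /nrm normr0. Qed.

Lemma nrm_eq0 x : nrm x = 0 -> x = 0.
Proof. by move=> x0; apply/eqP; rewrite -normr_eq0 nrmE x0. Qed.

Lemma nrmD x y : nrm (x + y) <= nrm x + nrm y.
Proof. by rewrite -lecR rmorphD /= -!nrmE ler_normD. Qed.

Lemma nrmN x : nrm (- x) = nrm x.
Proof. by rewrite /nrm normrN. Qed.

Lemma nrmB x y : nrm (x - y) <= nrm x + nrm y.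
Proof. by rewrite -(nrmN y) nrmD. Qed.

Lemma nrmZ (c : R[i]) x : nrm (c *: x) = normc c * nrm x.
Proof.
by apply: complexI; rewrite -nrmE normrZ nrmE rmorphM /=; congr (_ * _); case: c.
Qed.

Lemma nrm_ball x (e : R) y : ball x e%:C%C y <-> nrm (x - y) < e.
Proof. by rewrite -ball_normE /ball_ /= nrm_lt. Qed.

End Norm.

Lemma pos_complexE (R : realType) (e : R[i]) :
  0 < e -> e = (complex.Re e)%:C%C /\ 0 < complex.Re e.
Proof. by case: e => a b; rewrite ltcE /= => /andP[/eqP -> ?]. Qed.

Lemma geometric_tail_le (R : realType) (q : R) m n : 0 <= q ->
  (1 - q) * (\sum_(m <= k < n) q ^+ k) <= q ^+ m.
Proof.
move=> q0; have [mn|/ltnW nm] := leqP m n; last first.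
  by rewrite big_geq // mulr0 exprn_ge0.
rewrite big_distrr /= (eq_bigr (fun k => - (q ^+ k.+1) - - (q ^+ k))).
  by rewrite telescope_sumr // opprK addrC gerBl exprn_ge0.
by move=> k _; rewrite exprS; ring.
Qed.

(* Only the Zmodule structure of A is copied to this alias, which can then carry
   the ring structure given by mul and one. *)
Definition banach_ring (R : realType) (A : completeNormedModType R[i])
  (mul : A -> A -> A) (one : A) (H : comBanachAlgebra mul one) : Type := A.

Section BanachRing.
Variables (R : realType) (A : completeNormedModType R[i]).
Variables (mul : A -> A -> A) (one : A) (H : comBanachAlgebra mul one).
Local Notation B := (banach_ring H).
Local Notation nrm := (@nrm R A).

HB.instance Definition _ := GRing.Zmodule.copy B A.

Fact banach_mulA : associative (mul : B -> B -> B).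
Proof. by have [[]] := H. Qed.
Fact banach_mulC : commutative (mul : B -> B -> B).
Proof. by have [[]] := H. Qed.
Fact banach_mul1 : left_id (one : B) (mul : B -> B -> B).
Proof. by have [[]] := H. Qed.
Fact banach_mulDl : left_distributive (mul : B -> B -> B) +%R.
Proof.
by move=> x y z; rewrite !(banach_mulC _ z); have [[_ _ _ D] _] := H; exact: D.
Qed.
Fact banach_1neq0 : (one : B) != 0.
Proof. by have [_ []] := H. Qed.

HB.instance Definition _ := GRing.Zmodule_isComNzRing.Build B
  banach_mulA banach_mulC banach_mul1 banach_mulDl banach_1neq0.

Lemma banach_scaleE (c : R[i]) (x y : A) :
  (c *: x : B) * (y : B) = (c *: mul x y : A).
Proof. by have [_ [Z _ _]] := H; exact: Z. Qed.

Lemma nrmM (x y : B) : nrm (x * y : B) <= nrm x * nrm y.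
Proof.
by rewrite -lecR rmorphM /= -!nrmE; have [_ [_ _ M]] := H; exact: M.
Qed.

(** The factor [nrm 1] is there because the unit is not assumed to have norm 1. *)
Lemma nrmX (x : B) n : nrm (x ^+ n : B) <= nrm (1 : B) * nrm x ^+ n.
Proof.
elim: n => [|n IH]; first by rewrite !expr0 mulr1.
rewrite !exprS (le_trans (nrmM _ _)) // mulrCA ler_wpM2l //; exact: nrm_ge0.
Qed.

Lemma neumann (z : B) : nrm z < 1 -> exists y : B, (1 - z) * y = 1.
Proof.
set q := nrm z => q1.
have q0 : 0 <= q by exact: nrm_ge0.
pose C := nrm (1 : B).
have C0 : 0 <= C by exact: nrm_ge0.
have cvq : (fun n => q ^+ n) @ \oo --> (0 : R) by apply: cvg_expr; rewrite ger0_norm.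
pose s : A^nat := fun n => z ^+ n : B.
have tail m n : (1 - q) * nrm (\sum_(m <= k < n) s k) <= C * q ^+ m.
  apply: (@le_trans _ _ (C * ((1 - q) * \sum_(m <= k < n) q ^+ k))); last first.
    by rewrite ler_wpM2l // geometric_tail_le.
  rewrite mulrCA ler_wpM2l ?subr_ge0 ?(ltW q1) //.
  rewrite mulr_sumr; elim/big_ind2 : _ => [||k _]; first by rewrite nrm0.
    by move=> x a y b xa yb; rewrite (le_trans (nrmD _ _ _)) // lerD.
  exact: nrmX.
have small e : 0 < e -> exists n : nat, C * q ^+ n < e.
  move=> e0; have e1 : 0 < e / (C + 1) by rewrite divr_gt0 //; lra.
  have /cvgrPdist_lt/(_ _ e1) [n _ /(_ n (leqnn n))] := cvq.
  rewrite sub0r normrN ger0_norm ?exprn_ge0 // ltr_pdivlMr; last by lra.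
  by move=> h; exists n; have := exprn_ge0 n q0; lra.
have : cauchy (series s @ \oo).
  apply/cauchy_seriesP => e /pos_complexE[-> e0].
  have [|n nE] := small ((1 - q) * complex.Re e).
    by rewrite mulr_gt0 // subr_gt0.
  exists ([set k | n <= k]%N, [set k | n <= k]%N); first by split; exists n.
  case=> k l /= [nk _]; rewrite nrm_lt -(@ltr_pM2l _ (1 - q)) ?subr_gt0 //.
  apply: le_lt_trans nE; apply: (le_trans (tail k l)); rewrite ler_wpM2l //.
  by rewrite ler_wiXn2l // ltW.
move=> /cauchy_cvgP/cvg_ex[/= y sy].
(* The defect [(1 - z) * y - 1] equals [(1 - z) * (y - sn) - z ^+ n] for each partial sum [sn]; both
   terms are made at most [e / 2]. *)
exists (y : B); apply/subr0_eq/(@nrm_eq0 R A _)/eqP; rewrite eq_le nrm_ge0 andbT.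
apply/ler_addgt0Pl => e e0; rewrite addr0.
pose D := nrm (1 - z : B).
have D0 : 0 <= D by exact: nrm_ge0.
have e1 : 0 < e / 2 / (D + 1) by rewrite !divr_gt0 //; lra.
have [n1 n1E] := small _ (divr_gt0 e0 (ltr0n R 2)).
have /cvgrPdist_lt/(_ (e / 2 / (D + 1))%:C%C) := sy.
rewrite ltcR => /(_ e1) [n2 _ n2E].
pose n := maxn n1 n2.
have yn : nrm (y - series s n) < e / 2 / (D + 1).
  by rewrite -nrm_lt; apply: n2E; rewrite /= leq_maxr.
pose sn : B := series s n.
have snE : (1 - z) * sn = 1 - z ^+ n.
  rewrite -opprB mulNr -[RHS]opprB subrX1; congr (- (_ * _)).
  by rewrite /sn /series /= big_mkord.
have -> : (1 - z) * (y : B) - 1 = (1 - z) * ((y : B) - sn) - z ^+ n.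
  by rewrite mulrBr snE opprB; ring.
apply: (le_trans (nrmB _ _ _)).
have le1 : nrm ((1 - z) * ((y : B) - sn) : B) <= D * (e / 2 / (D + 1)).
  by rewrite (le_trans (nrmM _ _)) // ler_wpM2l // ltW.
have le2 : nrm (z ^+ n : B) <= e / 2.
  apply: (le_trans (nrmX _ _)); apply: le_trans (ltW n1E).
  by rewrite ler_wpM2l // ler_wiXn2l ?leq_maxl // ltW.
have E : e / 2 / (D + 1) * (D + 1) = e / 2 by rewrite mulfVK // gt_eqF //; lra.
lra.
Qed.
End BanachRing.

(** * Maximal ideals and characters *)

Section MaximalIdeal.
Variables (R : realType) (A : completeNormedModType R[i]).
Variables (mul : A -> A -> A) (one : A) (H : comBanachAlgebra mul one).
Local Notation B := (banach_ring H).
Local Notation nrm := (@nrm R A).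

Lemma near_one_unit (z : B) : nrm ((1 - z : B) : A) < 1 -> exists y : B, z * y = 1.
Proof. by move=> /neumann; rewrite subKr. Qed.

Variables (I : set A) (maxI : maximal_ideal mul one I).

(** The maximality proof is an argument so that the ideal structure, which depends on it, can be
    attached to the predicate. *)
Definition in_ideal of maximal_ideal mul one I : B -> bool := fun x => `[< I x >].
Local Notation P := (in_ideal maxI).

Fact in_ideal_closed : idealr_closed (P : {pred B}).
Proof.
have [[I0 ID IM] I1 _] := maxI; split.
- exact/asboolP.
- by apply/negP => /asboolP.
- by move=> a u v /asboolP Iu /asboolP Iv; apply/asboolP/ID => //; exact: IM.
Qed.
HB.instance Definition _ := isIdealr.Build B P in_ideal_closed.
Definition max_idealr : idealr B := P.

Definition residue : Type := {ideal_quot max_idealr}.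
HB.instance Definition _ := GRing.ComNzRing.copy residue {ideal_quot max_idealr}.

Definition res : B -> residue := \pi_({ideal_quot max_idealr})%qT.
HB.instance Definition _ := GRing.RMorphism.copy res (\pi_({ideal_quot max_idealr})%qT).

Lemma res_surj (q : residue) : exists x : B, res x = q.
Proof. by exists (repr (q : {ideal_quot max_idealr})); rewrite /res reprK. Qed.

Lemma res_eq0 (x : B) : res x = 0 <-> I x.
Proof.
rewrite -(rmorph0 res) /res; split=> [/eqP|Ix].
  by rewrite -Quotient.idealrBE subr0 => /asboolP.
by apply/eqP; rewrite -Quotient.idealrBE subr0; apply/asboolP.
Qed.

(* [xget] returns 0 when q has no inverse, in particular for q = 0. *)
Definition res_inv (q : residue) : residue := xget 0 [set p | p * q = 1].

Fact res_mulVf (q : residue) : q != 0 -> res_inv q * q = 1.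
Proof.
have [x <-] := res_surj q => x0.
suff [p pE] : exists p : residue, p * res x = 1.
  exact: (@xgetPex _ 0 [set p | p * res x = 1] (ex_intro _ p pE)).
have [[I0 ID IM] I1 Imax] := maxI.
(* [J] is the ideal generated by [x] and [I]. If it contains [one], the coefficient of [x] inverts
   [x] modulo [I]; otherwise maximality forces [x] into [I]. *)
pose J : set A := [set z | exists (a : B) (i : B), I i /\ z = (a * x + i : B)].
have Jideal : ideal mul J.
  split.
  - by exists 0, 0; split=> //; rewrite mul0r addr0.
  - move=> _ _ [a [i [Ii ->]]] [b [j [Ij ->]]].
    exists (a + b), (i + j); split; first exact: ID.
    by rewrite mulrDl; exact: (@addrACA B).
  - move=> c _ [a [i [Ii ->]]]; exists ((c : B) * a), ((c : B) * i).
    by split; [exact: IM | rewrite -mulrA; exact: (@mulrDr B)].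
have IJ : I `<=` J by move=> i Ii; exists 0, i; rewrite mul0r add0r.
have [[a [i [Ii oneE]]]|J1] := pselect (J one).
  exists (res a); rewrite -rmorphM.
  have {}oneE : (1 : B) = a * x + i := oneE.
  have -> : a * x = 1 - i by rewrite oneE addrK.
  by rewrite rmorphB rmorph1 [X in _ - X](_ : _ = 0) ?subr0 //; exact/res_eq0.
exfalso; move/eqP: x0; apply; apply/res_eq0.
rewrite -(Imax J) //; exists 1, 0; split=> //.
by rewrite mul1r addr0.
Qed.

Fact res_inv0 : res_inv 0 = 0.
Proof.
rewrite /res_inv; case: xgetP => // p _ /=.
by rewrite mulr0 => /esym/eqP; rewrite oner_eq0.
Qed.

HB.instance Definition _ := GRing.ComNzRing_isField.Build residue res_mulVf res_inv0.

Definition res_scalar (c : R[i]) : residue := res (c *: one : A).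

Fact res_scalar_zmod : zmod_morphism res_scalar.
Proof.
by move=> a b; rewrite /res_scalar scalerBl; exact: (rmorphB res).
Qed.
Fact res_scalar_monoid : monoid_morphism res_scalar.
Proof.
split; first by rewrite /res_scalar scale1r; exact: (rmorph1 res).
move=> a b; rewrite /res_scalar -(rmorphM res); congr res.
by rewrite banach_scaleE (banach_mul1 H (b *: one)) scalerA.
Qed.
HB.instance Definition _ := GRing.isZmodMorphism.Build _ _ res_scalar res_scalar_zmod.
HB.instance Definition _ := GRing.isMonoidMorphism.Build _ _ res_scalar res_scalar_monoid.

Lemma res_scale (c : R[i]) (x : A) : res (c *: x : A) = res_scalar c * res x.
Proof.
rewrite -[in LHS](banach_mul1 H x) -banach_scaleE.
exact: (rmorphM res).
Qed.

(** The quotient seminorm. *)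
Definition res_norm (q : residue) : R := inf [set nrm x | x in [set x | res x = q]].

Lemma res_norm_le (x : B) : res_norm (res x) <= nrm x.
Proof.
apply: ge_inf; last by exists x.
by exists 0 => _ [y _ <-]; exact: nrm_ge0.
Qed.

(** The factor [t] allows two successive applications to a product of two infima. *)
Lemma le_res_norm (q : residue) (c t : R) : 0 <= t ->
  (forall x : B, res x = q -> c <= t * nrm x) -> c <= t * res_norm q.
Proof.
rewrite le_eqVlt => /predU1P[<-|t0] h.
  by have [x xq] := res_surj q; have := h x xq; rewrite !mul0r.
rewrite mulrC -ler_pdivrMr //; apply: lb_le_inf.
  by have [x xq] := res_surj q; exists (nrm x), x.
by move=> _ [x xq <-]; rewrite ler_pdivrMr // mulrC; exact: h.
Qed.

Lemma maximal_ideal_scalar (x : B) : exists c : R[i], res x = res_scalar c.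
Proof.
have N0 q : 0 <= res_norm q.
  rewrite -[res_norm q]mul1r; apply: le_res_norm => // y _.
  by rewrite mul1r nrm_ge0.
apply: (@gelfand_mazur R residue res_scalar res_norm) => //.
- move=> p q; rewrite -lerBlDl -[leRHS]mul1r; apply: le_res_norm => // y yq.
  rewrite mul1r lerBlDl -lerBlDr -[leRHS]mul1r; apply: le_res_norm => // z zp.
  rewrite mul1r lerBlDr -zp -yq -rmorphD (le_trans (res_norm_le _)) //.
  exact: nrmD.
- move=> p q; apply: le_res_norm => // y yq.
  rewrite [leRHS]mulrC; apply: le_res_norm => [|z zp]; first exact: nrm_ge0.
  by rewrite -zp -yq -rmorphM (le_trans (res_norm_le _)) // [leRHS]mulrC nrmM.
- move=> c q; apply: le_res_norm => [|y <-]; first exact: normc_ge0.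
  by rewrite -res_scale -nrmZ; exact: res_norm_le.
(* If a representative [z] of 1 had norm below 1, then [1 - z] would lie in [I] and be invertible by
   the Neumann series. *)
- apply: (lt_le_trans ltr01).
  rewrite -[res_norm 1]mul1r; apply: le_res_norm => // z z1.
  rewrite mul1r leNgt; apply/negP => zlt.
  have [|y yE] := @near_one_unit (1 - z); first by rewrite subKr.
  have [[_ _ IM] I1 _] := maxI; apply: I1.
  have -> : one = mul y (1 - z : B) :> A.
    by rewrite (banach_mulC H); exact: (esym yE).
  apply/IM/res_eq0; rewrite rmorphB rmorph1 [X in _ - X](_ : _ = 1) ?subrr //.
Qed.

(** The character sends [x] to the scalar representing its residue class; its laws are pulled back
    along the injective [res_scalar]. *)
Lemma maximal_ideal_character :
  exists2 phi : A -> R[i], character mul one phi & forall x, phi x = 0 -> I x.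
Proof.
have [phi phiE] := choice maximal_ideal_scalar.
have inj : injective res_scalar by exact: fmorph_inj.
exists phi; last first.
  by move=> x x0; apply/res_eq0; rewrite phiE x0 rmorph0.
split.
- move=> a x y; apply: inj; rewrite -phiE [RHS]rmorphD [X in _ = X + _]rmorphM.
  by rewrite /= -!phiE -res_scale; exact: (rmorphD res).
- move=> x y; apply: inj; rewrite [RHS]rmorphM /= -!phiE; exact: (rmorphM res).
- by apply: inj; rewrite -phiE [RHS]rmorph1; exact: (rmorph1 res).
Qed.

End MaximalIdeal.

Section Character.
Variables (R : realType) (A : completeNormedModType R[i]).
Variables (mul : A -> A -> A) (one : A) (H : comBanachAlgebra mul one).
Local Notation nrm := (@nrm R A).
Variables (phi : A -> R[i]) (Hphi : character mul one phi).

Lemma characterZ c x : phi (c *: x) = c * phi x.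
Proof.
have [L _ _] := Hphi; have /esym/eqP := L 1 0 0.
rewrite scaler0 addr0 mul1r -subr_eq0 addrK => /eqP phi0.
by have := L c x 0; rewrite addr0 phi0 addr0.
Qed.

Lemma characterB x y : phi (x - y) = phi x - phi y.
Proof.
have [L _ _] := Hphi.
by rewrite addrC -scaleN1r L mulN1r addrC.
Qed.

(** If [phi x] exceeded [x] in norm, [z = x / phi x] would have norm below 1, so [1 - z] would be
    invertible, although [phi] vanishes on it. *)
Lemma character_contractive x : normc (phi x) <= nrm x.
Proof.
rewrite leNgt; apply/negP => lt.
have c0 : 0 < normc (phi x) by apply: le_lt_trans lt; exact: nrm_ge0.
have f0 : phi x != 0 by apply: contraTneq c0 => ->; rewrite normc0 ltxx.
pose z : banach_ring H := (phi x)^-1 *: x.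
have [|y yE] := @neumann _ _ _ _ H z.
  by rewrite /z nrmZ normcV mulrC ltr_pdivrMr // mul1r.
have [_ M phi1] := Hphi.
have : phi one = phi ((1 - z) * y) by rewrite yE.
rewrite phi1 (M (1 - z) y) (characterB one z) phi1 characterZ mulVf // subrr.
by rewrite mul0r => /eqP; rewrite oner_eq0.
Qed.

End Character.

Lemma separated_by_characters (R : realType) (A : completeNormedModType R[i])
    (mul : A -> A -> A) (one : A) :
  comBanachAlgebra mul one -> semisimple mul one ->
  forall f : A, (forall phi, character mul one phi -> phi f = 0) -> f = 0.
Proof.
move=> H ss f f0; apply: ss => I maxI.
by have [phi /f0 ? +] := maximal_ideal_character H maxI; apply.
Qed.

(** * Riesz operators *)

Section Operators.
Variables (R : realType) (A : completeNormedModType R[i]).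
Local Notation nrm := (@nrm R A).
Local Notation ball1 := [set x : A | `|x| <= 1].

Definition norm_bounded (S : A -> A) := exists M : R, forall x, `|x| <= 1 -> nrm (S x) <= M.

Lemma op_norm_ge (S : A -> A) x : norm_bounded S -> `|x| <= 1 ->
  nrm (S x) <= op_norm S.
Proof.
move=> [M SM] x1; apply: ub_le_sup; last by exists x.
by exists M => _ [y y1 <-]; exact: SM.
Qed.

Lemma bounded_operator_iter (S : A -> A) n :
  bounded_operator S -> norm_bounded (iter n S).
Proof.
(* The given bound [M] is complex; comparing real parts replaces it by the nonnegative real [m]. *)
move=> [_ [M SM]]; pose m := `|complex.Re M|.
have Sm x : nrm (S x) <= m * nrm x.
  have := SM x; rewrite !nrmE lecE => /andP[_] /= le.
  apply: (le_trans le); case: (M) @m {le} => a b /=.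
  by rewrite mulr0 subr0 ler_wpM2r ?nrm_ge0 ?ler_norm.
exists (m ^+ n) => x; rewrite -[1 in X in _ <= X]/(1%:C%C) nrm_le => x1.
have : nrm (iter n S x) <= m ^+ n * nrm x.
  elim: n => [|n IH]; first by rewrite mul1r.
  by rewrite iterS (le_trans (Sm _)) // exprS -mulrA ler_wpM2l /m.
move=> /le_trans; apply; rewrite -[leRHS]mulr1 ler_wpM2l // exprn_ge0 /m //.
Qed.

Lemma compact_nrm_bounded (S : set A) : compact S ->
  exists M : R, forall x, S x -> nrm x <= M.
Proof.
move=> /compact_near_coveringP/(_ R (+oo%R) (fun M x => nrm x <= M) _).
case=> [x _|M0 [_ /(_ (M0 + 1)) bnd]]; last first.
  by exists (M0 + 1) => x Sx; apply: bnd => //; rewrite ltrDl.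
exists (ball x 1%:C%C, [set M | nrm x + 1 < M]).
  split; first by apply: nbhsx_ballx; rewrite ltcR; lra.
  by exists (nrm x + 1); split; rewrite ?num_real.
case=> y M [/= xy xM]; move: xy; rewrite nrm_ball // => xy.
have -> : y = x - (x - y) by rewrite subKr.
by have := @nrmB R A x (x - y); lra.
Qed.

Lemma compact_operator_bounded (K : A -> A) :
  compact_operator K -> norm_bounded K.
Proof.
move=> [_ /compact_nrm_bounded[M KM]]; exists M => x x1.
by apply/KM/subset_closure; exists x.
Qed.

(** This makes the set whose infimum defines [ess_norm] nonempty. *)
Lemma compact_operator0 : compact_operator (fun=> 0 : A).
Proof.
split; first by move=> a x y; rewrite scaler0 addr0.
have -> : (fun=> 0) @` ball1 = [set (0 : A)].
  apply/seteqP; split => [_ [? _ <-] //|_ ->].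
  by exists 0 => //=; rewrite normr0 ler01.
have /closure_id <- : closed [set (0 : A)]; last exact: compact_set1.
by apply: compact_closed; [exact: norm_hausdorff | exact: compact_set1].
Qed.

Lemma riesz_compact_approx (T : A -> A) (e : R) : riesz_operator T ->
  0 < e -> e <= 1 -> exists p (K : A -> A), compact_operator K /\
    forall x, `|x| <= 1 -> nrm (iter p T x - K x) <= e.
Proof.
move=> [Tb Tlim] e0 e1.
(* The index [p0.+1] is positive, so [e <= 1] gives [e <= e^(1/p)], and an essential norm of at
   least [e] would contradict the choice of [p0]. *)
have /cvgrPdist_lt/(_ _ e0) [p0 _ /(_ p0.+1 (leqnSn _))] := Tlim.
rewrite sub0r normrN ger0_norm ?powR_ge0 //; set p := p0.+1.
move=> small; have : ess_norm (iter p T) < e.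
  rewrite ltNge; apply/negP => le; move: small; apply/negP; rewrite -leNgt.
  apply: (@le_trans _ _ (powR e p%:R^-1)).
    rewrite -{1}(powRr1 (ltW e0)); apply: ger_powR; first by rewrite e0.
    by rewrite invf_le1 ?ltr0n // ler1n.
  apply: ge0_ler_powR => //; rewrite nnegrE; first exact: ltW.
  exact: le_trans (ltW e0) le.
move=> /inf_lt[|_ [K Kc <-] lt].
  by exists (op_norm (fun x => iter p T x - 0)), (fun=> 0); [exact: compact_operator0|].
exists p, K; split=> // x x1; apply: le_trans (ltW lt).
apply: (@op_norm_ge (fun x => iter p T x - K x)) => //.
have [M1 TM] := bounded_operator_iter p Tb.
have [M2 KM] := compact_operator_bounded Kc.
exists (M1 + M2) => y y1; apply: (le_trans (nrmB _ _ _)).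
by rewrite lerD ?TM ?KM.
Qed.

(** Each [g n] is fixed by [iter p T], hence within 1/16 of [K (g n)]. These images have a cluster
    point [y]; two of them within 1/16 of [y] put the corresponding [g n] and [g m] within 4/16 of
    each other. *)
Lemma riesz_fixed_not_separated (T : A -> A) (g : nat -> A) : riesz_operator T ->
  (forall n, T (g n) = g n) -> (forall n, `|g n| <= 1) ->
  ~ (forall n m, (n < m)%N -> 2^-1 <= nrm (g n - g m)).
Proof.
move=> Tr gT g1 gsep.
have [||p [K [[_ Kc] TK]]] := @riesz_compact_approx T 16^-1 Tr; try lra.
have gK n : nrm (g n - K (g n)) <= 16^-1.
  have := TK _ (g1 n); rewrite (_ : iter p T (g n) = g n) //.
  by elim: (p) => //= k ->.
have [|y [_ ycl]] := Kc ((fun n => K (g n)) @ \oo) _.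
  by exists 0%N => // n _; apply: subset_closure; exists (g n) => //; exact: g1.
have yball : nbhs y (ball y (16^-1)%:C%C) by apply: nbhsx_ballx; rewrite ltcR; lra.
have [|_ [[n _ <-] /nrm_ball yn]] := ycl (range (fun n => K (g n))) _ _ yball.
  by exists 0%N => // k _; exists k.
have [|_ [[m nm <-] /nrm_ball ym]] :=
    ycl [set K (g m) | m in [set m | (n < m)%N]] _ _ yball.
  by exists n.+1 => // k nk; exists k.
have := gsep n m nm.
have -> : g n - g m = (g n - K (g n)) - (y - K (g n)) +
    ((y - K (g m)) - (g m - K (g m))).
  by rewrite !opprB !addrA !subrK.
have := @nrmD R A (g n - K (g n) - (y - K (g n))) (y - K (g m) - (g m - K (g m))).
have := @nrmB R A (g n - K (g n)) (y - K (g n)).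
have := @nrmB R A (y - K (g m)) (g m - K (g m)).
have := gK n; have := gK m; lra.
Qed.

End Operators.

(** * Fixed points of a Riesz endomorphism *)

Section FixedSpace.
Variables (R : realType) (A : completeNormedModType R[i]).
Variables (mul : A -> A -> A) (one : A) (T : A -> A).
Hypotheses (H : comBanachAlgebra mul one) (Tu : unital_endomorphism mul one T).
Hypothesis Tr : riesz_operator T.
Local Notation B := (banach_ring H).
Local Notation nrm := (@nrm R A).

Let TL : is_linear T. Proof. by have [] := Tu. Qed.
Let TM x y : T (mul x y) = mul (T x) (T y). Proof. by have [] := Tu. Qed.
Let T1 : T one = one. Proof. by have [] := Tu. Qed.

Let TZ c x : T x = x -> T (c *: x) = c *: x.
Proof.
move=> Tx; have T0 : T 0 = 0.
  by have := TL (-1) one one; rewrite scaleN1r addNr => ->; rewrite scaleN1r addNr.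
by have := TL c x 0; rewrite !addr0 T0 addr0 Tx.
Qed.

Let TB x y : T x = x -> T y = y -> T (x - y) = x - y.
Proof. by move=> Tx Ty; have := TL (-1) y x; rewrite !scaleN1r Tx Ty !(addrC (- y)). Qed.

Variable f : A.
Hypothesis Tf : T f = f.
Variable phi : nat -> A -> R[i].
Hypothesis phi_char : forall n, character mul one (phi n).
Hypothesis phi_f_inj : injective (fun n => phi n f).

Let M n := [set g : A | T g = g /\ forall i, (i < n)%N -> phi i g = 0].

Let M_Z n c g : M n g -> M n (c *: g).
Proof.
move=> [Tg g0]; split; first exact: TZ.
by move=> i /g0 gi0; rewrite (characterZ (phi_char i)) gi0 mulr0.
Qed.

Let M_B n x y : M n x -> M n y -> M n (x - y).
Proof.
move=> [Tx x0] [Ty y0]; split; first exact: TB.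
by move=> i ni; rewrite (characterB (phi_char i)) x0 // y0 // subrr.
Qed.

(* The witness is the product of the f - phi_i(f) for i < n. *)
Let M_neq0 n : exists2 g, M n g & phi n g != 0.
Proof.
pose u := fix u k : A := if k is k'.+1 then mul (u k') (f - phi k' f *: one) else one.
have uE k m : phi m (u k) = \prod_(i < k) (phi m f - phi i f).
  have [_ pM p1] := phi_char m.
  elim: k => [|k IH]; first by rewrite big_ord0 p1.
  rewrite big_ord_recr /= -IH pM (characterB (phi_char m)).
  by rewrite (characterZ (phi_char m)) p1 mulr1.
exists (u n).
  split.
    by elim: n => //= k IH; rewrite TM IH TB // TZ.
  by move=> i ni; rewrite uE (bigD1 (Ordinal ni)) //= subrr mul0r.
rewrite uE prodf_seq_neq0; apply/allP => i _ /=.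
rewrite subr_eq0; apply/eqP => /phi_f_inj E.
by have := ltn_ord i; rewrite -E ltnn.
Qed.

(** The supremum of this set is the norm of [phi n] restricted to [M n]. *)
Let values n := [set normc (phi n g) | g in [set g | M n g /\ nrm g <= 1]].

Let M0 n : M n 0.
Proof.
have [g Mg _] := M_neq0 n.
by rewrite -(subrr g); exact: M_B.
Qed.

Let values_nonempty n : values n !=set0.
Proof.
exists (normc (phi n 0)), 0 => //; split; first exact: M0.
by rewrite nrm0 ler01.
Qed.

Let values_le n g : M n g -> normc (phi n g) <= sup (values n) * nrm g.
Proof.
move=> Mg; have [/nrm_eq0 g0|g0] := eqVneq (nrm g) 0.
  have := character_contractive H (phi_char n) g.
  by rewrite g0 nrm0 mulr0.
have g_gt0 : 0 < nrm g by rewrite lt_def g0 nrm_ge0.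
rewrite -ler_pdivrMr //; apply: ub_le_sup.
  exists 1 => _ [x [_ x1] <-].
  exact: le_trans (character_contractive H (phi_char n) x) x1.
exists (((nrm g)^-1)%:C%C *: g).
  split; first exact: M_Z.
  by rewrite nrmZ normc_real ger0_norm ?invr_ge0 ?nrm_ge0 // mulVf.
rewrite (characterZ (phi_char n)) normcM normc_real ger0_norm ?invr_ge0 ?nrm_ge0 //.
exact: mulrC.
Qed.

Let sup_gt0 n : 0 < sup (values n).
Proof.
have [g Mg g0] := M_neq0 n.
have := values_le Mg; apply: contraTT; rewrite -leNgt -ltNge => s0.
apply: (@le_lt_trans _ _ 0); first by rewrite mulr_le0_ge0 ?nrm_ge0.
by rewrite lt_def normc_ge0 andbT; apply: contra_neq g0; exact: eq0_normc.
Qed.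

Lemma fixed_character_values_not_injective : False.
Proof.
have /choice[g gE] : forall n, exists g : A,
    [/\ M n g, nrm g <= 1 & sup (values n) / 2 < normc (phi n g)].
  move=> n; have := sup_gt0 n; set s := sup _ => s0.
  have [||_ [g [Mg g1] <-] lt] := @sup_gt R (values n) (s / 2).
  - exact: values_nonempty.
  - by rewrite -/s; lra.
  - by exists g.
apply: (@riesz_fixed_not_separated _ _ T g Tr).
- by move=> n; have [[]] := gE n.
- by move=> n; have [_ g1 _] := gE n; rewrite -[1]/(1%:C%C) nrm_le.
move=> n m nm.
have [Mn _ gn] := gE n; have [[Tm gm0] _ _] := gE m.
have Mm : M n (g m) by split=> // i ni; apply: gm0; exact: ltn_trans nm.
(* Since [g m] is in [M m] and [n < m], [phi n] kills it. With [s] the norm of [phi n] on [M n],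
   this gives [s / 2 < normc (phi n (g n - g m)) <= s * nrm (g n - g m)]. *)
have := values_le (M_B Mn Mm).
rewrite (characterB (phi_char n)) (gm0 n nm) subr0 => le.
have := sup_gt0 n => s0.
by rewrite -(ler_pM2l s0) (le_trans _ le) // ltW.
Qed.

End FixedSpace.

Lemma fixed_character_values_finite (R : realType) (A : completeNormedModType R[i])
    (mul : A -> A -> A) (one : A) (T : A -> A) (f : A) :
  comBanachAlgebra mul one -> unital_endomorphism mul one T ->
  riesz_operator T -> T f = f ->
  finite_set [set phi f | phi in [set phi | character mul one phi]].
Proof.
(* An infinite set of values would contain an injective sequence [v], and choosing a character for
   each term contradicts the previous lemma. *)
move=> H Tu Tr Tf; apply: contrapT => /infiniteP le.
have [v] := elimT (@pcard_leP nat (R[i] : numFieldType) setT _) le.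
have /choice[phi phiE] : forall n, exists phi, character mul one phi /\ phi f = v n.
  by move=> n; have /= [phi ? ?] := @funS _ _ _ _ v n Logic.I; exists phi.
apply: (@fixed_character_values_not_injective _ _ _ _ _ H Tu Tr f Tf phi).
  by move=> n; have [] := phiE n.
move=> n m /=; have [_ ->] := phiE n; have [_ ->] := phiE m.
by apply: (@inj _ _ _ v); rewrite inE.
Qed.

(** * Connectedness and the dimension of the fixed space *)

Lemma finite_set_isolated (R : realType) (V : set R[i]) (c : R[i]) :
  finite_set V -> exists2 e : R, 0 < e & forall v, V v -> normc (v - c) < e -> v = c.
Proof.
move=> /finite_seqP[s ->]; elim: s => [|w s [e e0 IH]]; first by exists 1.
have [wc|wc] := eqVneq w c.
  by exists e => // v /=; rewrite inE => /predU1P[->|/IH].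
have d0 : 0 < normc (w - c).
  by rewrite lt_def normc_ge0 andbT; apply: contra_neq wc => /eq0_normc/subr0_eq.
exists (Num.min e (normc (w - c))); first by rewrite lt_min e0.
move=> v /=; rewrite inE lt_min => /predU1P[->|/IH vs] /andP[ve vw]; last exact: vs.
by rewrite ltxx in vw.
Qed.

(** The characters agreeing with [phi] at [f] form an open set because the value [phi f] is
    isolated; those disagreeing form an open set because evaluation at [f] is continuous.
    Connectedness makes one of them empty. *)
Lemma connected_finite_values (R : realType) (A : completeNormedModType R[i])
    (mul : A -> A -> A) (one : A) (f : A) (phi : A -> R[i]) :
  max_ideal_space_connected mul one ->
  finite_set [set phi f | phi in [set phi | character mul one phi]] ->
  character mul one phi -> forall psi, character mul one psi -> psi f = phi f.
Proof.
move=> conn /(@finite_set_isolated _ _ (phi f))[e e0 iso] Hphi psi Hpsi.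
have normE (z : R[i]) : `|z| = (normc z)%:C%C by case: z.
pose U := [set chi | character mul one chi /\ chi f = phi f].
pose V := [set chi | character mul one chi /\ chi f <> phi f].
have [||||U0|V0] := conn U V _ _ _ _.
- split=> [chi [] //|chi [Hchi chif]].
  exists [:: f], e%:C%C; split; first by rewrite ltcR.
  move=> xi Hxi /(_ f); rewrite inE eqxx chif normE ltcR => /(_ isT) lt.
  by split=> //; apply: iso => //; exists xi.
- split=> [chi [] //|chi [Hchi /eqP chif]].
  exists [:: f], `|chi f - phi f|; split; first by rewrite normr_gt0 subr_eq0.
  move=> xi Hxi /(_ f); rewrite inE eqxx => /(_ isT) lt.
  by split=> // xif; move: lt; rewrite xif distrC ltxx.
- by move=> chi Hchi; have [?|?] := pselect (chi f = phi f); [left|right].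
- by apply/seteqP; split=> // chi [[_ ?] [_]].
- by have : U phi by []; rewrite U0.
- by apply: contrapT => ne; have : V psi by []; rewrite V0.
Qed.

Unset Implicit Arguments.

Theorem theorem2p1 (R : realType) (A : completeNormedModType (R[i]))
  (mul : A -> A -> A) (one : A) (T : A -> A) :
  comBanachAlgebra mul one ->
  semisimple mul one -> max_ideal_space_connected mul one ->
  unital_endomorphism mul one T -> riesz_operator T ->
  [set f : A | T f = f] = [set c *: one | c in [set: R[i]]].
Proof.
move=> H ss conn Tu Tr; have [TL _ T1] := Tu.
apply/seteqP; split=> [f /= Tf|_ [c _ <-] /=]; last first.
  have T0 : T 0 = 0.
    by have := TL (-1) one one; rewrite scaleN1r addNr => ->; rewrite scaleN1r addNr.
  by have := TL c one 0; rewrite !addr0 T0 addr0 T1.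
have [[phi Hphi]|no_char] := pselect (exists phi, character mul one phi).
  exists (phi f) => //; apply/esym/subr0_eq.
  apply: (separated_by_characters H ss) => psi Hpsi.
  have [_ _ psi1] := Hpsi.
  rewrite (characterB Hpsi) (characterZ Hpsi) psi1 mulr1.
  rewrite (connected_finite_values conn _ Hphi Hpsi) ?subrr //.
  exact: fixed_character_values_finite H Tu Tr Tf.
(* When there are no characters, separation holds vacuously and gives [f = 0]. *)
exists 0 => //; rewrite scale0r; apply/esym.
by apply: (separated_by_characters H ss) => psi Hpsi; case: no_char; exists psi.
Qed.
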